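(* Let $0<\mu<L$ and let $K=\{\lambda\in\mathbb{C}:\ \mu\le\operatorname{Re}\lambda,\ |\lambda|\le L\}$. Then the asymptotic convergence factor of $K$ satisfies $$\underline{\rho}(K)>\frac{L-\mu}{L+\mu}=1-\frac{2\mu}{L+\mu}.$$
   Context: For an integer $t\ge1$, $\mathcal{P}_t$ is the set of real polynomials $p$ of degree at most $t$ with $p(0)=1$. For a compact set $K\subset\mathbb{C}$ symmetric with respect to the real axis, the asymptotic convergence factor is $$\underline{\rho}(K)=\inf_{t\ge1}\ \min_{p_t\in\mathcal{P}_t}\ \max_{\lambda\in K}|p_t(\lambda)|^{1/t}.$$ *)

(* Defs.v *)
(* MathComp / MathComp-Analysis, over an arbitrary R : realType; the complex
   numbers are R[i] from mathcomp-real-closed. *)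
From HB Require Import structures.
From mathcomp Require Import all_boot all_order all_algebra.
From mathcomp Require Import complex.
From mathcomp Require Import all_classical all_reals all_analysis.

Set Implicit Arguments.
Unset Strict Implicit.
Unset Printing Implicit Defensive.

Import Order.TTheory GRing.Theory Num.Theory.

Local Open Scope classical_set_scope.
Local Open Scope ring_scope.

(* The modulus as an element of R (the norm `|z| of R[i] has values in R[i]). *)
Definition cmod (R : realType) (z : R[i]) : R := ComplexField.Normc.normc z.

(* p(z) for a real polynomial p and a complex number z *)
Definition ceval (R : realType) (p : {poly R}) (z : R[i]) : R[i] :=
  (map_poly (real_complex R) p).[z].

Definition residual_polys (R : realType) (t : nat) : set {poly R} :=
  [set p : {poly R} | (size p <= t.+1)%N /\ p.[0] = 1].

(* max_{z in K} |p(z)|^{1/t}. For K compact and nonempty the supremum is that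
   of a bounded nonempty set of reals, and it is attained. *)
Definition root_max (R : realType) (K : set R[i]) (t : nat) (p : {poly R}) : R :=
  sup [set cmod (ceval p z) `^ (t%:R^-1) | z in K].

(* min_{p in P_t} max_{z in K} |p(z)|^{1/t}. The infimum is over a nonempty set
   (it contains p = 1) of nonnegative reals. *)
Definition root_minmax (R : realType) (K : set R[i]) (t : nat) : R :=
  inf [set root_max K t p | p in @residual_polys R t].

(* Meaningful for K compact and nonempty; symmetry of K is what allows one to
   restrict to real polynomials, and is not needed to define the quantity. *)
Definition asymptotic_convergence_factor (R : realType) (K : set R[i]) : R :=
  inf [set root_minmax K t | t in [set t : nat | (1 <= t)%N]].

Definition truncated_disk (R : realType) (mu L : R) : set R[i] :=
  [set z | mu <= complex.Re z /\ cmod z <= L].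

(* Main.v *)
Require Import Defs.
From mathcomp Require Import all_boot all_order all_algebra.
From mathcomp Require Import all_classical all_reals all_analysis.
From mathcomp Require Import complex cyclic separable cyclotomic ring lra zify.
Import Order.TTheory GRing.Theory Num.Theory.
Local Open Scope ring_scope.

(* With c = (L + mu)/2 and r = (L - mu)/2, the set K contains the disk of centre
   c and radius r, whose convergence factor is r/c.  It also contains the larger
   Cassini region E = {z : |(z - c)^2 + b| <= 4 b} with b = r^2/3, whose factor
   sqrt (4 b / (c^2 + b)) exceeds r/c because r < c.
   To bound p from below on E, write the even part of p(c + u)^(2m) as g(u^2):
   then w |-> g(w - b) is a polynomial of degree <= m t, bounded by M^(2m) on
   |w| <= 4 b when |p| <= M on E.  At w = c^2 + b it equals
   (p(0)^(2m) + p(2c)^(2m))/2 >= 1/2, as p(2c) is real, while Cauchy's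
   coefficient estimates bound it by (m t + 1) M^(2m) ((c^2 + b)/(4 b))^(m t).
   Letting m tend to infinity gives M^2 >= (4 b / (c^2 + b))^t. *)

(** * Growth of polynomials outside a disk *)

(** In characteristic zero ['X^n - 1] is separable, so it has n distinct roots, and n distinct n-th
    roots of unity in a field include a primitive one. *)
Lemma closed_prim_root_exists (C : numClosedFieldType) (n : nat) :
  (0 < n)%N -> exists z : C, n.-primitive_root z.
Proof.
move=> n_gt0; pose p : {poly C} := 'X^n - 1.
have [r Dp] := closed_field_poly_normal p.
move: Dp; rewrite lead_coefXnsubC// scale1r => Dp.
have rn1 : all n.-unity_root r.
  by apply/allP => z; rewrite -root_prod_XsubC -Dp.
have sz_r : (n < (size r).+1)%N.
  by rewrite -(size_prod_XsubC r id) -Dp size_XnsubC.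
have [|z] := hasP (has_prim_root n_gt0 rn1 _ sz_r); last by exists z.
by rewrite -separable_prod_XsubC -Dp separable_Xn_sub_1 // pnatr_eq0 -lt0n.
Qed.

(* Averaging h against the N-th roots of unity, N > deg h, isolates one
   coefficient. *)
Lemma cauchy_coef_bound (C : numClosedFieldType) (h : {poly C}) (r M : C) :
  0 < r -> (forall w, `|w| <= r -> `|h.[w]| <= M) ->
  forall k, `|h`_k| * r ^+ k <= M.
Proof.
move=> r0 hM k.
have M0 : 0 <= M by apply: le_trans (hM 0 _) => //; rewrite normr0 ltW.
have [kh|kh] := leqP (size h) k; first by rewrite nth_default// normr0 mul0r.
set N := size h in kh.
have N0 : (0 < N)%N by apply: leq_ltn_trans kh.
have [z zP] := @closed_prim_root_exists C N N0.
have zN := prim_expr_order zP.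
have nz : `|z| = 1.
  by apply/eqP; rewrite -(@pexpr_eq1 _ _ N)// -normrX zN normr1.
have z0 : z != 0 by rewrite -normr_gt0 nz.
have key : \sum_(j < N) h.[r * z ^+ j] * (z ^- k) ^+ j = N%:R * (h`_k * r ^+ k).
  transitivity (\sum_(j < N) \sum_(i < N)
      (h`_i * r ^+ i) * (z ^+ i / z ^+ k) ^+ j).
    apply: eq_bigr => j _; rewrite horner_coef mulr_suml.
    by apply: eq_bigr => i _; rewrite !exprMn -!exprM mulnC; ring.
  rewrite exchange_big /= (bigD1 (Ordinal kh))//= [X in _ + X]big1 => [|i ik].
    rewrite addr0 divff ?expf_neq0//.
    under eq_bigr do rewrite expr1n mulr1.
    by rewrite sumr_const card_ord mulr_natl.
  (* For i different from k, x is an N-th root of unity other than 1, so its geometric sum vanishes: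
     multiplied by x - 1 it gives x^N - 1 = 0. *)
  rewrite -mulr_sumr; set x := z ^+ i / z ^+ k.
  have x1 : x - 1 != 0.
    rewrite subr_eq0 /x; apply/eqP => /divr1_eq e.
    move/eqP: e; rewrite (eq_prim_root_expr zP) !modn_small// => /eqP e.
    by move/eqP: ik; apply; apply: val_inj.
  apply/eqP; rewrite mulf_eq0; apply/orP; right.
  rewrite -(mulrI_eq0 _ (mulfI x1)) -subrX1 /x expr_div_n -!exprM.
  by rewrite ![(_ * N)%N]mulnC !exprM zN !expr1n divr1 subrr.
have NC : (0 : C) < N%:R by rewrite ltr0n.
rewrite -(ler_pM2l NC).
have -> : N%:R * (`|h`_k| * r ^+ k) = `|N%:R * (h`_k * r ^+ k)|.
  by rewrite !normrM normr_nat normrX (gtr0_norm r0).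
rewrite -key; apply: le_trans (ler_norm_sum _ _ _) _.
rewrite -[X in X%:R * _](card_ord N) mulr_natl -sumr_const.
apply: ler_sum => j _.
rewrite normrM normrX normfV normrX nz expr1n invr1 expr1n mulr1.
by apply: hM; rewrite normrM normrX nz expr1n mulr1 gtr0_norm.
Qed.

(** Cauchy's estimates bound the term of degree i by M (|x|/r)^i, and |x|/r >= 1 lets every exponent
    be raised to d. The crude factor d + 1 is harmless, as it disappears in the limit of high
    powers. *)
Lemma bernstein_disk (C : numClosedFieldType) (h : {poly C}) (d : nat)
    (r M x : C) :
  0 < r -> (forall w, `|w| <= r -> `|h.[w]| <= M) -> (size h <= d.+1)%N ->
  r <= `|x| -> `|h.[x]| <= d.+1%:R * (M * (`|x| / r) ^+ d).
Proof.
move=> r0 hM hd rx.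
have M0 : 0 <= M by apply: le_trans (hM 0 _) => //; rewrite normr0 ltW.
rewrite (horner_coef_wide _ hd); apply: le_trans (ler_norm_sum _ _ _) _.
rewrite -[X in X%:R * _](card_ord d.+1) mulr_natl -sumr_const.
apply: ler_sum => i _.
have -> : `|h`_i * x ^+ i| = (`|h`_i| * r ^+ i) * (`|x| / r) ^+ i.
  by rewrite normrM normrX expr_div_n; field; rewrite expf_neq0// gt_eqF.
apply: ler_pM.
- by rewrite mulr_ge0// exprn_ge0// ltW.
- by rewrite exprn_ge0// divr_ge0// ltW.
- exact: cauchy_coef_bound.
- by apply: ler_weXn2l; [rewrite ler_pdivlMr ?mul1r | rewrite -ltnS].
Qed.

Lemma horner_even_poly (A : comNzRingType) (p : {poly A}) (u : A) :
  2 * (even_poly p).[u ^+ 2] = p.[u] + p.[- u].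
Proof.
rewrite -[in RHS](poly_even_odd p) !(hornerD, hornerMX, horner_comp, hornerX).
by rewrite mulrNN -expr2; ring.
Qed.

(* If q < 1, write q^-1 = 1 + e.  Along m = 2k, Bernoulli's inequality gives
   (1 + e)^(2k) >= (k e)^2, which outgrows the linear factor. *)
Lemma poly_geometric_ge1 (R : archiRealFieldType) (q : R) (t : nat) : 0 <= q ->
  (forall m, 1 <= 2 * ((m * t).+1%:R * q ^+ m)) -> 1 <= q.
Proof.
move=> q0 H; rewrite leNgt; apply/negP => q1.
have qp : 0 < q.
  rewrite lt_neqAle q0 andbT; apply/eqP => e.
  by have := H 1%N; rewrite -e expr1 !mulr0 ler10.
pose e := q^-1 - 1.
have e0 : 0 < e by rewrite subr_gt0 invf_gt1.
have qe : q * (1 + e) = 1 by rewrite /e addrC subrK mulfV ?gt_eqF.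
have bern k : 1 + k%:R * e <= (1 + e) ^+ k.
  elim: k => [|k IH]; first by rewrite mul0r addr0 expr0.
  rewrite exprS -natr1.
  have : (1 + e) * (1 + k%:R * e) <= (1 + e) * (1 + e) ^+ k.
    by rewrite ler_pM2l//; lra.
  have : 0 <= k%:R * (e * e) by rewrite mulr_ge0// mulr_ge0 ?ltW.
  lra.
have bound k : (k%:R * e) ^+ 2 <= 2 * (k.*2 * t).+1%:R.
  have E : (q * (1 + e)) ^+ k.*2 = 1 by rewrite qe expr1n.
  have := H k.*2; have : 0 < (1 + e) ^+ k.*2 by rewrite exprn_gt0//; lra.
  move=> P; rewrite -(ler_pM2r P) mul1r => Hk.
  have {}Hk : (1 + e) ^+ k.*2 <= 2 * (k.*2 * t).+1%:R.
    by apply: le_trans Hk _; rewrite -!mulrA -exprMn E mulr1.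
  apply: le_trans _ Hk; rewrite -muln2 exprM; apply: lerXn2r.
  - by rewrite nnegrE mulr_ge0// ltW.
  - by rewrite nnegrE exprn_ge0//; lra.
  - by apply: le_trans (bern k); lra.
(* For K >= 1 one has 2 (2 K t + 1) <= K (4 t + 2), so any K > T violates [bound]. *)
pose T : R := (4 * t + 2)%:R / e ^+ 2.
have [k kT] : exists k, T < k.+1%:R.
  exists (Num.bound T).
  apply: lt_trans (archi_boundP _) _.
    by rewrite divr_ge0// exprn_ge0// ltW.
  by rewrite ltr_nat.
have := bound k.+1; rewrite leNgt => /negP; apply.
apply: (@le_lt_trans _ _ (k.+1%:R * (4 * t + 2)%:R)).
  rewrite -!natrM ler_nat; nia.
rewrite exprMn expr2 -mulrA ltr_pM2l ?ltr0n//.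
by rewrite -ltr_pdivrMr// exprn_gt0.
Qed.

(** * The lower bound on a Cassini region *)

Local Notation toC := (real_complex _).

Lemma normc_cmod (R : realType) (z : R[i]) : `|z| = toC (cmod z).
Proof. by []. Qed.

Lemma cassini_bound (R : realType) (c r b M : R) (t : nat) (p : {poly R}) :
  0 < r -> r < c -> 3 * b = r ^+ 2 -> residual_polys t p ->
  (forall z : R[i], cmod ((z - toC c) ^+ 2 + toC b) <= 4 * b ->
     cmod (ceval p z) <= M) ->
  1 <= M ^+ 2 * ((c ^+ 2 + b) / (4 * b)) ^+ t.
Proof.
move=> r0 rc rb [sp p0] hM.
have b0 : 0 < b by have : 0 < r ^+ 2 := exprn_gt0 2 r0; lra.
(* This puts the evaluation point c^2 + b outside the disk |w| <= 4 b. *)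
have cb : 3 * b < c ^+ 2 by rewrite rb; nra.
have M0 : 0 <= M.
  apply: le_trans (hM (toC c) _); first by rewrite -ler0c -normc_cmod.
  by rewrite -lecR -normc_cmod subrr expr0n add0r ger0_norm ?lecR ?ler0c; lra.
apply: (@poly_geometric_ge1 _ _ t) => [|m].
  by rewrite mulr_ge0 ?exprn_ge0// divr_ge0//; lra.
pose P := map_poly (real_complex R) p.
(* The even exponent keeps p(2c)^(2m) >= 0, so it cannot cancel p(0)^(2m) = 1 in the even part. *)
pose F := (P \Po ('X + (toC c)%:P)) ^+ m.*2.
have FE u : F.[u] = (ceval p (u + toC c)) ^+ m.*2.
  by rewrite /F horner_exp horner_comp !hornerE.
pose h := even_poly F \Po ('X - (toC b)%:P).
have hE u : 2 * h.[u ^+ 2 + toC b] = F.[u] + F.[- u].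
  by rewrite -horner_even_poly /h horner_comp !hornerE addrK.
have sF : (size F <= (m.*2 * t).+1)%N.
  apply: leq_trans (size_poly_exp_leq _ _) _; rewrite ltnS mulnC leq_mul2l.
  rewrite size_comp_poly2 ?size_XaddC// size_map_poly.
  by rewrite -subn1 leq_subLR add1n sp orbT.
have sh : (size h <= (m * t).+1)%N.
  rewrite /h size_comp_poly2 ?size_XsubC//.
  apply: leq_trans (size_even_poly _) _; rewrite leq_uphalf_double.
  by apply: leq_trans sF _; rewrite doubleS doubleMl.
have hbound w : `|w| <= toC (4 * b) -> `|h.[w]| <= toC (M ^+ m.*2).
  (* Both c + u and c - u lie in the Cassini region, since (-u)^2 + b = u^2 + b = w. *)
  move=> hw; pose u := sqrtC (w - toC b).
  have uw : w = u ^+ 2 + toC b by rewrite sqrtCK subrK.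
  have Fu v : v ^+ 2 = u ^+ 2 -> `|F.[v]| <= toC (M ^+ m.*2).
    move=> vu; rewrite FE normrX rmorphXn/=; apply: lerXn2r.
    - by rewrite nnegrE.
    - by rewrite nnegrE ler0c.
    - rewrite normc_cmod lecR; apply: hM.
      by rewrite addrK vu -uw -lecR -normc_cmod.
  rewrite -(ler_pM2l (ltr0n _ 2)) -[X in X * _ <= _]normr_nat -normrM uw hE.
  apply: le_trans (ler_normD _ _) _; rewrite mulr_natl mulr2n.
  by apply: lerD; apply: Fu; rewrite ?sqrrN.
have b4 : 0 < toC (4 * b) by rewrite ltcR; lra.
have c2b : `|toC c ^+ 2 + toC b| = toC (c ^+ 2 + b).
  by rewrite -rmorphXn -rmorphD ger0_norm// ler0c; lra.
have := @bernstein_disk _ h (m * t) _ _ (toC c ^+ 2 + toC b) b4 hbound sh.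
rewrite c2b lecR => /(_ ltac:(lra)) H.
have : 1 <= 2 * `|h.[toC c ^+ 2 + toC b]|.
  rewrite -[X in X * _]normr_nat -normrM hE !FE addNr.
  rewrite /ceval -[0](rmorph0 (real_complex R)).
  rewrite -rmorphD !horner_map p0 -!rmorphXn -rmorphD/= expr1n.
  rewrite -mul2n exprM.
  have E : 0 <= p.[c + c] ^+ 2 ^+ m by rewrite exprn_ge0// sqr_ge0.
  by rewrite ger0_norm ?ler0c ?lecR ?lerDr// addr_ge0.
move=> /le_trans/(_ (ler_wpM2l (ler0n _ 2) H)).
rewrite -(rmorph_nat (real_complex R) 2) -(rmorph_nat (real_complex R) (m * t).+1).
rewrite -(fmorphV (real_complex R)).
rewrite -!(rmorphM (real_complex R)) -(rmorphXn (real_complex R)).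
rewrite -!(rmorphM (real_complex R)) -(rmorph1 (real_complex R)) lecR.
by rewrite [(_ * _ ^+ t) ^+ m]exprMn -!exprM mul2n [(t * m)%N]mulnC.
Qed.

(** * The Cassini region inside the truncated disk *)

(** The relation 3 b = r^2 makes u^2 + b = 4 b at u = r and u = -r, so the oval meets the real axis
    exactly at c - r and c + r. *)
Lemma cassini_sub_truncated_disk (R : realType) (c r b x y : R) :
  0 < r -> r < c -> 3 * b = r ^+ 2 ->
  (x ^+ 2 - y ^+ 2 + b) ^+ 2 + (2 * x * y) ^+ 2 <= (4 * b) ^+ 2 ->
  c - r <= c + x /\ (c + x) ^+ 2 + y ^+ 2 <= (c + r) ^+ 2.
Proof.
move=> r0 rc rb.
have b0 : 0 < b by have : 0 < r ^+ 2 := exprn_gt0 2 r0; lra.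
set X := x ^+ 2; set Y := y ^+ 2 => H.
have X0 : 0 <= X by exact: sqr_ge0.
have Y0 : 0 <= Y by exact: sqr_ge0.
have {}H : (X + Y) ^+ 2 + 2 * b * (X - Y) <= 15 * b ^+ 2.
  by move: H; rewrite !exprMn -/X -/Y; lra.
(* Otherwise X^2 + 2 b X > 15 b^2 already, while the remaining terms 2 (X - b) Y + Y^2 are
   nonnegative. *)
have Xr : X <= 3 * b.
  rewrite leNgt; apply/negP => Xb.
  have : 0 <= (X - b) * Y by rewrite mulr_ge0//; lra.
  nra.
have xr : `|x| <= r.
  by rewrite -(ger0_norm (ltW r0)) -!sqrtr_sqr ler_wsqrtr// -rb.
move: xr; rewrite ler_norml => /andP[xr1 xr2]; split; first by lra.
have S : X + Y <= 6 * b - X.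
  (* By [H] the right side exceeds the left by at least (3 b - X)^2. *)
  have : (X + Y - b) ^+ 2 <= (5 * b - X) ^+ 2 by nra.
  move=> S2; rewrite leNgt; apply/negP => hS; nra.
(* By [S], the disk inequality reduces to r^2 - x^2 <= 2 c (r - x). *)
have : 0 <= (r - x) * (2 * c - (r + x)) by rewrite mulr_ge0//; lra.
rewrite sqrrD -/X; move: S rb; rewrite /X; lra.
Qed.

Lemma cmod_leP (R : realType) (a d M : R) : 0 <= M ->
  cmod (Complex a d) <= M <-> a ^+ 2 + d ^+ 2 <= M ^+ 2.
Proof.
by move=> M0; rewrite /cmod /= -{1}(ger0_norm M0) -sqrtr_sqr ler_sqrt ?sqr_ge0.
Qed.

(** * From pointwise bounds to the convergence factor *)

(** Ensures that the [sup] in [root_max] is a genuine upper bound; on an unbounded set [sup] would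
    take its default value 0. *)
Lemma truncated_disk_bounded (R : realType) (mu L : R) (p : {poly R}) :
  exists B, forall z, truncated_disk mu L z -> cmod (ceval p z) <= B.
Proof.
exists (\sum_(i < size p) `|p`_i| * L ^+ i) => z [_ zL].
rewrite -lecR -normc_cmod /ceval horner_coef size_map_poly rmorph_sum/=.
apply: le_trans (ler_norm_sum _ _ _) _; apply: ler_sum => i _.
rewrite coef_map /= normrM normrX rmorphM rmorphXn/=; apply: ler_pM => //.
- by rewrite normc_def/= expr0n addr0 sqrtr_sqr.
- by rewrite lerXn2r ?nnegrE// ?normc_cmod ?lecR ?ler0c// (le_trans _ zL)//
    -ler0c -normc_cmod.
Qed.

(** With s the root maximum, |p| <= s^t on the Cassini region; [cassini_bound] with M = s^t and a
    t-th root bound s^2 from below. The bound is uniform in t and p, so it survives both infima. *)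
Lemma root_max_truncated_disk (R : realType) (mu L c r b : R) (t : nat)
    (p : {poly R}) :
  0 < r -> r < c -> 3 * b = r ^+ 2 -> c - r = mu -> c + r = L ->
  (0 < t)%N -> residual_polys t p ->
  Num.sqrt (4 * b / (c ^+ 2 + b)) <= root_max (truncated_disk mu L) t p.
Proof.
move=> r0 rc rb muE LE t0 pt.
have b0 : 0 < b by have : 0 < r ^+ 2 := exprn_gt0 2 r0; lra.
have cb0 : 0 < c ^+ 2 + b by rewrite ltr_wpDl ?sqr_ge0.
set K := truncated_disk mu L; set s := root_max _ _ _.
have cm0 z : 0 <= cmod (ceval p z) by rewrite -ler0c -normc_cmod.
have tK (x : R) : 0 <= x -> (x `^ t%:R^-1) ^+ t = x.
  by move=> x0; rewrite -powR_mulrn ?powR_ge0// -powRrM mulVf ?powRr1//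
    pnatr_eq0 -lt0n.
have ubK z : K z -> cmod (ceval p z) `^ t%:R^-1 <= s.
  move=> Kz; apply: ub_le_sup; last by exists z.
  have [B BP] := @truncated_disk_bounded R mu L p.
  exists (B `^ t%:R^-1) => _ [w Kw <-].
  have wB := BP _ Kw.
  by apply: ge0_ler_powR; rewrite ?nnegrE ?invr_ge0//; exact: le_trans wB.
have Kc : K (toC c).
  split => /=; first by lra.
  by apply/cmod_leP; [lra|rewrite expr0n addr0; nra].
have s0 : 0 <= s by apply: le_trans (ubK _ Kc); exact: powR_ge0.
have : 1 <= (s ^+ t) ^+ 2 * ((c ^+ 2 + b) / (4 * b)) ^+ t.
  apply: (@cassini_bound R c r b (s ^+ t) t p r0 rc rb pt) => z hz.
  rewrite -[leLHS]tK//; apply: lerXn2r; rewrite ?nnegrE ?powR_ge0//.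
  apply: ubK; case: z hz => x y; set w := (w in cmod w).
  have -> : w = Complex ((x - c) ^+ 2 - y ^+ 2 + b) (2 * (x - c) * y).
    by rewrite /w !expr2; congr Complex; ring.
  move/cmod_leP => /(_ ltac:(lra)).
  move=> /(@cassini_sub_truncated_disk _ _ _ _ _ _ r0 rc rb).
  rewrite subrKC muE LE => -[h1 h2]; split => //=.
  by apply/cmod_leP; lra.
have k0 : 0 <= (c ^+ 2 + b) / (4 * b) by rewrite divr_ge0 ?ltW// mulr_gt0.
rewrite exprAC -exprMn expr_ge1 ?(mulr_ge0 (sqr_ge0 s) k0)//.
rewrite mulrA ler_pdivlMr ?mul1r ?mulr_gt0// => H.
rewrite -[leRHS](ger0_norm s0) -sqrtr_sqr ler_sqrt ?sqr_ge0//.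
by rewrite ler_pdivrMr.
Qed.

Theorem corollary1 (R : realType) (mu L : R) (hmu : 0 < mu) (hL : mu < L) :
  asymptotic_convergence_factor (truncated_disk mu L) > (L - mu) / (L + mu) /\
  (L - mu) / (L + mu) = 1 - (2 * mu) / (L + mu).
Proof.
have Lmu : L + mu != 0 by rewrite gt_eqF//; lra.
split; last by field.
pose c := (L + mu) / 2; pose r := (L - mu) / 2; pose b := r ^+ 2 / 3.
have r0 : 0 < r by rewrite /r; lra.
have rc : r < c by rewrite /r /c; lra.
have rb : 3 * b = r ^+ 2 by rewrite /b; field.
have muE : c - r = mu by rewrite /c /r; field.
have LE : c + r = L by rewrite /c /r; field.
have b0 : 0 < b by have : 0 < r ^+ 2 := exprn_gt0 2 r0; lra.
have cb0 : 0 < c ^+ 2 + b by rewrite ltr_wpDl ?sqr_ge0.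
have c0 : 0 < c by lra.
have k0 : 0 < 4 * b / (c ^+ 2 + b) by apply: divr_gt0 => //; exact: mulr_gt0.
apply: (@lt_le_trans _ _ (Num.sqrt (4 * b / (c ^+ 2 + b)))); last first.
  rewrite /asymptotic_convergence_factor; apply: lb_le_inf.
    by exists (root_minmax (truncated_disk mu L) 1), 1%N.
  move=> _ [t /= t1 <-]; rewrite /root_minmax; apply: lb_le_inf.
    exists (root_max (truncated_disk mu L) t 1), 1 => //.
    by split; rewrite ?size_poly1 ?hornerE.
  move=> _ [p pt <-].
  exact: (@root_max_truncated_disk _ _ _ _ _ _ _ _ r0 rc rb muE LE).
have -> : (L - mu) / (L + mu) = r / c by rewrite /r /c; field; rewrite Lmu.
have rc0 : 0 <= r / c by rewrite divr_ge0 ?ltW.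
rewrite -[ltLHS](ger0_norm rc0) -sqrtr_sqr.
rewrite ltr_sqrt ?k0//.
(* With r^2 = 3 b the claim becomes 3 b (c^2 + b) < 4 b c^2, which is 3 b < c^2, that is r < c. *)
rewrite expr_div_n ltr_pdivrMr ?exprn_gt0// mulrAC ltr_pdivlMr// -rb.
have : r ^+ 2 < c ^+ 2 by rewrite ltr_pXn2r ?nnegrE ?ltW.
by rewrite -rb; nra.
Qed.
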